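(* Let $G$ be a linear algebraic group over an algebraically closed field $\Bbbk$ and $V$ a $G$-module. Then $$\delta(G,V)\le\sigma(G,V)\le\beta_{\mathrm{sep}}(G,V)\le\beta(G,V).$$
   Context: A $G$-module is a finite dimensional rational representation $V$ of $G$ over $\Bbbk$. $\Bbbk[V]$ is the ring of polynomial functions $V\to\Bbbk$, with action $(g\cdot f)(v)=f(g^{-1}v)$, and $\Bbbk[V]^G$ is its graded subring of invariants. $\Bbbk[V]^G_{\le d}$ is the set of invariants of degree at most $d$ (including $0$). For $S\subseteq\Bbbk[V]$, $S_+$ denotes the set of elements of $S$ with constant term zero. The nullcone is $\mathcal{N}_{G,V}=\{v\in V : f(v)=0 \text{ for all } f\in\Bbbk[V]^G_+\}$. Let $S\subseteq\Bbbk[V]^G$. $S$ is a $\delta$-set if for all $v\in V^G\setminus\mathcal{N}_{G,V}$ there is $f\in S_+$ with $f(v)\ne0$. $S$ is a $\sigma$-set if for all $v\in V\setminus\mathcal{N}_{G,V}$ there is $f\in S_+$ with $f(v)\neq0$. $S$ is a separating set if for any $v,w\in V$ such that some $f\in\Bbbk[V]^G$ has $f(v)\ne f(w)$, there is $s\in S$ with $s(v)\ne s(w)$. The numbers $\delta(G,V)$, $\sigma(G,V)$, $\beta_{\mathrm{sep}}(G,V)$, $\beta(G,V)$ are the minimal $d\ge0$ such that $\Bbbk[V]^G_{\le d}$ is, respectively, a $\delta$-set, a $\sigma$-set, a separating set, a generating set of $\Bbbk[V]^G$ as a $\Bbbk$-algebra ($\beta(G,V)=\infty$ if no such $d$ exists).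 *)

(* Defs.v *)
From HB Require Import structures.
From mathcomp Require Import all_boot all_order all_algebra.
(* [mpoly] must precede [constructive_ereal]: in the other order their notation
   levels conflict. *)
From mathcomp Require Import mpoly.
From mathcomp Require Import boolp classical_sets constructive_ereal.

Set Implicit Arguments.
Unset Strict Implicit.
Unset Printing Implicit Defensive.

Import Order.TTheory GRing.Theory.
Local Open Scope classical_set_scope.
Local Open Scope ring_scope.

(* [p] in variables X_1..X_n, composed with [x : T -> k^n], is the function [f]. *)
Definition represents (k : closedFieldType) (T : Type) (n : nat)
    (x : T -> 'rV[k]_n) (p : {mpoly k[n]}) (f : T -> k) : Prop :=
  forall t, f t = p.@[x t 0].

Definition polynomial_in (k : closedFieldType) (T : Type) (n : nat)
    (x : T -> 'rV[k]_n) (f : T -> k) : Prop :=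
  exists p, represents x p f.

(* An affine variety (a Zariski-closed subset of k^N, the image of [lag_coord])
   with a group structure whose multiplication and inverse are morphisms of
   varieties. *)
Record linearAlgebraicGroup (k : closedFieldType) := LinearAlgebraicGroup {
  lag_group :> groupType;
  lag_dim : nat;
  lag_coord : lag_group -> 'rV[k]_lag_dim;
  lag_coord_inj : injective lag_coord;
  lag_closed : exists I : set {mpoly k[lag_dim]},
    range lag_coord = [set x | forall p, I p -> p.@[x 0] = 0];
  lag_mul_regular : forall i,
    polynomial_in
      (fun gh : lag_group * lag_group =>
         row_mx (lag_coord gh.1) (lag_coord gh.2))
      (fun gh => lag_coord (gh.1 * gh.2)%g 0 i);
  lag_inv_regular : forall i,
    polynomial_in lag_coord (fun g => lag_coord (g^-1)%g 0 i)
}.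

Definition vcoord (k : closedFieldType) (V : vectType k) (v : V) :
    'rV[k]_(\dim {:V}) :=
  \row_i coord (vbasis {:V}) i v.

Record gModule (k : closedFieldType) (G : linearAlgebraicGroup k) := GModule {
  gmod_space :> vectType k;
  gact : G -> 'End(gmod_space);
  gact1 : forall v, gact 1%g v = v;
  gactM : forall g h v, gact (g * h)%g v = gact g (gact h v);
  gact_rational : forall v i,
    polynomial_in (@lag_coord k G) (fun g => vcoord (gact g v) 0 i)
}.

Section Invariants.
Variables (k : closedFieldType) (G : linearAlgebraicGroup k) (V : gModule G).
Implicit Types (S : set (V -> k)) (d : nat).

(* As k is infinite, a polynomial function is represented by a unique
   polynomial, so its degree and constant term are those of any
   representative. *)

Definition polyfun : set (V -> k) := polynomial_in (@vcoord k V).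

Definition polyfun_le d : set (V -> k) :=
  [set f | exists2 p, represents (@vcoord k V) p f & (msize p <= d.+1)%N].

Definition constant_term_zero (f : V -> k) : Prop :=
  exists2 p, represents (@vcoord k V) p f & p@_0 = 0.

Definition fun_act (g : G) (f : V -> k) : V -> k := fun v => f (gact V (g^-1)%g v).

Definition invariants : set (V -> k) :=
  [set f | polyfun f /\ forall g, fun_act g f = f].

Definition invariants_le d : set (V -> k) := invariants `&` polyfun_le d.

Definition plus_part S : set (V -> k) := [set f | S f /\ constant_term_zero f].

Definition fixed_points : set V := [set v | forall g : G, gact V g v = v].

Definition nullcone : set V :=
  [set v | forall f, plus_part invariants f -> f v = 0].

Definition delta_set S : Prop :=
  forall v, (fixed_points `\` nullcone) v -> exists2 f, plus_part S f & f v <> 0.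

Definition sigma_set S : Prop :=
  forall v, (~` nullcone) v -> exists2 f, plus_part S f & f v <> 0.

Definition separating_set S : Prop :=
  forall v w, (exists2 f, invariants f & f v <> f w) ->
    exists2 s, S s & s v <> s w.

Definition generating_set S : Prop :=
  forall f, invariants f -> exists (r : nat) (s : 'I_r -> V -> k),
    (forall i, S (s i)) /\ polynomial_in (fun v => \row_i s i v) f.

End Invariants.

Arguments polyfun {k G} V.
Arguments polyfun_le {k G} V.
Arguments invariants {k G} V.
Arguments invariants_le {k G} V.
Arguments fixed_points {k G} V.
Arguments nullcone {k G} V.

(* The least natural number satisfying [P], or infinity if there is none;
   [\bar int] is used for its copy of the naturals extended by infinity. *)
Definition min_degree (P : nat -> Prop) : \bar int :=
  if pselect (exists d, `[< P d >]) is left exP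
  then ((ex_minn exP)%:Z)%:E else +oo%E.

Section Numbers.
Variables (k : closedFieldType) (G : linearAlgebraicGroup k) (V : gModule G).

Definition delta : \bar int := min_degree (fun d => delta_set (invariants_le V d)).

Definition sigma : \bar int := min_degree (fun d => sigma_set (invariants_le V d)).

Definition beta_sep : \bar int :=
  min_degree (fun d => separating_set (invariants_le V d)).

Definition beta : \bar int :=
  min_degree (fun d => generating_set (invariants_le V d)).

End Numbers.

(* Main.v *)
Require Import Defs.
From HB Require Import structures.
From mathcomp Require Import all_boot all_order all_algebra.
From mathcomp Require Import mpoly.
From mathcomp Require Import boolp classical_sets constructive_ereal.

(** Each inequality follows from an implication between properties of one set
    [S] of invariants: a generating set is separating, a separating set that is
    stable under [f |-> f - f(0)] is a [sigma_set], and a [sigma_set] is a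
    [delta_set]. The least degree for which a property holds can only decrease
    when the property is weakened ([le_min_degree]).

    The first implication holds because a polynomial in functions that agree at
    [v] and [w] also agrees there; the third is a restriction to fixed points.
    The second ([sigma_set_of_separating]) rests on the fact that the constant
    term of a polynomial function is its value at the origin. A point [v]
    outside the nullcone is thus separated from [0] by an invariant, hence by
    some [s] in [S], and [s - s(0)] has constant term zero and does not vanish
    at [v]. The invariants of degree at most [d] are stable in this sense, since
    subtracting a constant preserves both the invariance and the degree bound. *)

Set Implicit Arguments.
Unset Strict Implicit.
Unset Printing Implicit Defensive.

Import Order.TTheory GRing.Theory.
Local Open Scope classical_set_scope.
Local Open Scope ring_scope.

Lemma meval_at0 (R : comNzRingType) n (p : {mpoly R[n]}) :
  p.@[fun=> 0] = p@_0.
Proof.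
rewrite {1 2}[p]mpolyE !raddf_sum /=; apply: eq_bigr => m _.
rewrite mevalZ mevalX mcoeffZ mcoeffX; congr (_ * _).
have [->|m_neq0] := eqVneq m 0%MM.
  by apply: big1 => i _; rewrite mnm0E expr0.
have /existsP[i mi_neq0] : [exists i, m i != 0%N].
  apply: contraNT m_neq0; rewrite negb_exists => /forallP m0.
  by apply/eqP/mnmP => i; rewrite mnm0E; apply/eqP/negbNE/m0.
by rewrite (bigD1 i) //= expr0n (negPf mi_neq0) mul0r.
Qed.

Lemma le_min_degree (P Q : nat -> Prop) :
  (forall d, P d -> Q d) -> (min_degree Q <= min_degree P)%E.
Proof.
move=> PQ; rewrite /min_degree.
case: (pselect (exists d, `[< P d >])) => [exP|_]; last exact: leey.
case: pselect => [exQ|nexQ].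
  case: ex_minnP => m _ min_m; case: ex_minnP => n /asboolP Pn _.
  by rewrite lee_fin lez_nat; apply/min_m/asboolP/PQ.
by case: exP nexQ => d /asboolP Pd []; exists d; apply/asboolP/PQ.
Qed.

Section Implications.
Variables (k : closedFieldType) (G : linearAlgebraicGroup k) (V : gModule G).
Implicit Types (S : set (V -> k)) (f : V -> k) (p : {mpoly k[\dim {:V}]}).

Lemma represents_at0 p f : represents (@vcoord k V) p f -> f 0 = p@_0.
Proof.
move=> ->; rewrite -meval_at0; apply: meval_eq => i.
by rewrite /vcoord mxE linear0.
Qed.

Lemma represents_subC p f c : represents (@vcoord k V) p f ->
  represents (@vcoord k V) (p - c%:MP) (fun v => f v - c).
Proof. by move=> pf v; rewrite mevalB mevalC pf. Qed.

Lemma constant_term_zero_at0 f : constant_term_zero f -> f 0 = 0.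
Proof. by case=> p /represents_at0 ->. Qed.

Lemma constant_term_zero_sub_at0 f :
  polyfun V f -> constant_term_zero (fun v => f v - f 0).
Proof.
case=> p pf; exists (p - (f 0)%:MP); first exact: represents_subC.
by rewrite mcoeffB mcoeffC eqxx mulr1 (represents_at0 pf) subrr.
Qed.

Lemma invariants_subC f c : invariants V f -> invariants V (fun v => f v - c).
Proof.
case=> -[p pf] inv_f; split.
  by exists (p - c%:MP); exact: represents_subC.
by move=> g; rewrite -[in RHS](inv_f g).
Qed.

Lemma polyfun_le_subC d f c :
  polyfun_le V d f -> polyfun_le V d (fun v => f v - c).
Proof.
case=> p pf le_p; exists (p - c%:MP); first exact: represents_subC.
apply: leq_trans (msizeD_le _ _) _.
by rewrite msizeN geq_max le_p msizeC; case: eqP.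
Qed.

Lemma invariants_le_subC d f c :
  invariants_le V d f -> invariants_le V d (fun v => f v - c).
Proof.
by case=> inv_f le_f; split; [exact: invariants_subC|exact: polyfun_le_subC].
Qed.

Lemma delta_set_of_sigma S : sigma_set S -> delta_set S.
Proof. by move=> sigS v [_]; exact: sigS. Qed.

(** The stability hypothesis supplies elements of [plus_part S]: a separating
    set may consist of functions with nonzero constant term only. *)
Lemma sigma_set_of_separating S :
    S `<=` polyfun V -> (forall f, S f -> S (fun v => f v - f 0)) ->
  separating_set S -> sigma_set S.
Proof.
move=> polyS stabS sepS v /existsNP[f /not_implyP[[inv_f f0] fv]].
have [|s Ss sv] := sepS v 0.
  by exists f => //; rewrite (constant_term_zero_at0 f0).
exists (fun w => s w - s 0); last by move/subr0_eq.
by split; [exact: stabS|exact/constant_term_zero_sub_at0/polyS].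
Qed.

Lemma separating_set_of_generating S : generating_set S -> separating_set S.
Proof.
move=> genS v w [f inv_f fvw].
have [r [s [Ss [p pf]]]] := genS f inv_f.
have [i sivw] : exists i, s i v <> s i w.
  apply/existsNP => svw; apply: fvw; rewrite !pf.
  by apply: meval_eq => i; rewrite !mxE.
by exists (s i).
Qed.

End Implications.

Theorem proposition1p4 (k : closedFieldType) (G : linearAlgebraicGroup k)
    (V : gModule G) :
  [/\ (delta V <= sigma V)%E, (sigma V <= beta_sep V)%E
    & (beta_sep V <= beta V)%E].
Proof.
split; apply: le_min_degree => d.
- exact: delta_set_of_sigma.
- apply: sigma_set_of_separating => [f [[]] //|f].
  exact: invariants_le_subC.
- exact: separating_set_of_generating.
Qed.
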